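(* Let $C$ be a multi-rotationally symmetric planar convex body with minimal degree $\chi_C\geq 3$. Let $k_C$ be the maximal degree of $C$, let $\{k_1=\chi_C,\ldots,k_n=k_C\}$ with $k_1<\ldots<k_n$ be the set of divisors of $k_C$ greater than $1$, and let $P_{k_i}$ be the standard $k_i$-partition associated to $C$, $i=1,\ldots,n$. Then the chain of inequalities $d_M(P_{k_1})\geq\ldots\geq d_M(P_{k_n})$ is a chain of equalities (that is, $d_M(P_{k_1})=\ldots=d_M(P_{k_n})$) if and only if $\chi_C\geq 7$.
   Context: A planar convex body is a compact convex subset of $\mathbb{R}^2$ with non-empty interior. For $k\in\mathbb{N}$, $k\geq 2$, a planar convex body $C$ is $k$-rotationally symmetric if there is a point $p\in C$ (the center of symmetry of $C$) such that $C$ is invariant under the rotation of angle $2\pi/k$ about $p$. $C$ is multi-rotationally symmetric if it is $k$-rotationally symmetric for more than one value of $k$. The minimal degree $\chi_C$ is the smallest $k\geq 2$ for which $C$ is $k$-rotationally symmetric; if $C$ is not a circle (i.e. a disk), the maximal degree $k_C$ is the largest such $k$. (A circle has minimal degree $2$.) $C$ is $k$-rotationally symmetric exactly when $k$ is a divisor of $k_C$ greater than $1$. Standard $k$-partition: let $C$ be $k$-rotationally symmetric with center of symmetry $p$. Let $x_1,\ldots,x_k$ be points of $\partial C$ at minimal distance to $p$, symmetrically placed along $\partial C$ (they are the images of one such point under the rotations about $p$ of angles that are multiples of $2\pi/k$). The line segments $\overline{p\,x_i}$ divide $C$ into $k$ connected congruent (closed) subsets $C_1,\ldots,C_k$; this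 decomposition is the standard $k$-partition $P_k$ associated to $C$. The maximum relative diameter of a decomposition $P$ of $C$ into subsets $C_1,\ldots,C_k$ is $d_M(P)=\max\{D(C_i): i=1,\ldots,k\}$, where $D(C_i)=\max\{d(x,y):x,y\in C_i\}$ is the Euclidean diameter. *)

(* Defs.v *)
From HB Require Import structures.
From mathcomp Require Import all_boot all_order all_algebra.
From mathcomp Require Import all_classical all_reals all_analysis.

Set Implicit Arguments.
Unset Strict Implicit.
Unset Printing Implicit Defensive.

Import Order.TTheory GRing.Theory Num.Theory.
Import numFieldNormedType.Exports.

Local Open Scope classical_set_scope.
Local Open Scope ring_scope.

(* The library norm on R * R is the max norm: it induces the usual topology
   (used below for compactness, interior and closure), but not the Euclidean
   distance, which is therefore written out. *)
Definition edist (R : realType) (x y : R * R) : R :=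
  Num.sqrt ((x.1 - y.1) ^+ 2 + (x.2 - y.2) ^+ 2).

Definition diameter (R : realType) (A : set (R * R)) : R :=
  sup [set edist x y | x in A & y in A].

Definition boundary (T : topologicalType) (A : set T) : set T :=
  closure A `\` interior A.

Definition convex_body (R : realType) (C : set (R * R)) : Prop :=
  [/\ compact C, convex_set C & interior C !=set0].

(* Counterclockwise rotation of angle t about p. *)
Definition rotation (R : realType) (p : R * R) (t : R) (x : R * R) : R * R :=
  (p.1 + cos t * (x.1 - p.1) - sin t * (x.2 - p.2),
   p.2 + sin t * (x.1 - p.1) + cos t * (x.2 - p.2)).

Definition center_of_symmetry (R : realType) (C : set (R * R)) (k : nat)
    (p : R * R) : Prop :=
  C p /\ rotation p (2 * pi / k%:R) @` C = C.

Definition rot_symmetric (R : realType) (C : set (R * R)) (k : nat) : Prop :=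
  (2 <= k)%N /\ exists p, center_of_symmetry C k p.

Definition multi_rot_symmetric (R : realType) (C : set (R * R)) : Prop :=
  exists k l, [/\ k <> l, rot_symmetric C k & rot_symmetric C l].

Definition minimal_degree (R : realType) (C : set (R * R)) (chi : nat) : Prop :=
  rot_symmetric C chi /\ forall k, rot_symmetric C k -> (chi <= k)%N.

Definition maximal_degree (R : realType) (C : set (R * R)) (m : nat) : Prop :=
  rot_symmetric C m /\ forall k, rot_symmetric C k -> (k <= m)%N.

Definition closest_boundary_point (R : realType) (C : set (R * R))
    (p x : R * R) : Prop :=
  boundary C x /\ forall y, boundary C y -> edist p x <= edist p y.

(* With x_j the rotation of x about p of angle 2 pi j / k, this is the closed
   part of C between the segments [p, x_i] and [p, x_(i+1)]: the points of C
   met by the ray from p through x when it turns from x_i to x_(i+1). *)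
Definition standard_piece (R : realType) (C : set (R * R)) (k : nat)
    (p x : R * R) (i : 'I_k) : set (R * R) :=
  C `&` [set y | exists s t : R,
    [/\ 0 <= s, 2 * pi * i%:R / k%:R <= t, t <= 2 * pi * i.+1%:R / k%:R
      & y = rotation p t (p + s *: (x - p))]].

Definition standard_partition (R : realType) (C : set (R * R)) (k : nat)
    (P : 'I_k -> set (R * R)) : Prop :=
  exists p x, [/\ center_of_symmetry C k p, closest_boundary_point C p x
    & forall i, P i = standard_piece C p x i].

Definition max_rel_diameter (R : realType) (k : nat)
    (P : 'I_k -> set (R * R)) : R :=
  \big[Num.max/0]_(i < k) diameter (P i).

(* Main.v *)
From Pilot Require Import Defs.
From mathcomp Require Import all_boot all_order all_algebra.
From mathcomp Require Import all_classical all_reals all_analysis.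
From mathcomp Require Import ring lra.

Import Order.TTheory GRing.Theory Num.Theory.
Import numFieldNormedType.Exports.
(* [edist] must mean the Euclidean distance, not the extended-real one. *)
Import Pilot.Defs.

(** Let [p] be the center of [C], [r] the distance from [p] to the boundary and
    [rho] the largest distance from [p] to a point of [C] (the circumradius
    below). All degrees of symmetry share the center [p]: nontrivial
    rotations about two distinct points commute up to a nonzero translation, and a
    bounded set is invariant under no such translation ([center_unique]).
    Hence the angles leaving [C] invariant form a group, so [chi] divides [kC];
    being the least divisor of [kC] greater than 1, [chi] is prime.

    If [k >= 6], a piece of the standard [k]-partition lies in a sector of
    angle at most [pi / 3] with apex [p]. Two points of such a sector are no
    further apart than the more distant of them is from [p], whence
    [d_M(P_k) = rho] ([max_rel_diameter_narrow]). When [chi >= 7] this applies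
    to every divisor and the chain is constant.

    When [chi < 7], primality and [chi >= 3] leave [chi = 3] and [chi = 5].
    Since [kC] is a proper multiple of [chi], it is at least 6, and
    [d_M(P_kC) = rho]. The chord joining two consecutive endpoints [x_i] shows
    that [d_M(P_chi)] is at least [2 r sin(pi / chi)] ([closest_chord_le]).
    On the other hand, the perpendicular to the radius at a closest boundary
    point is a supporting line ([closest_supporting_line]), so [C] lies in the
    regular [kC]-gon circumscribed about the disk of radius [r], and
    [rho cos(pi / kC) <= r] ([circumradius_cos_le]). As
    [cos^2(pi / kC) >= 3/4] while [4 sin^2(pi / chi) = 2 (1 - cos(2 pi / chi))]
    exceeds [4/3], the two ends of the chain differ
    ([few_pieces_gt_circumradius]). *)

Local Open Scope classical_set_scope.
Local Open Scope ring_scope.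

Set Implicit Arguments.
Unset Strict Implicit.
Unset Printing Implicit Defensive.

(** * Trigonometric estimates *)

Lemma le_cos_norm {R : realType} (s t : R) :
  `|s| <= t -> t <= pi -> cos t <= cos s.
Proof.
move=> st tpi; rewrite -(cos_norm s).
have t0 : 0 <= t by exact: le_trans (normr_ge0 s) st.
move: st; rewrite le_eqVlt => /predU1P[->//|st]; apply: ltW.
by rewrite ltr_cos// in_itv/= ?t0 ?tpi ?normr_ge0 ?(le_trans (ltW st)).
Qed.

Lemma cos_double {R : realType} (x : R) : cos (2 * x) = 2 * cos x ^+ 2 - 1.
Proof. by rewrite mulrC mulr_natr cos_mulr2n -mulr_natl. Qed.

Lemma cos_triple {R : realType} (x : R) :
  cos (3 * x) = 4 * cos x ^+ 3 - 3 * cos x.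
Proof.
have -> : 3 * x = x + x + x by ring.
rewrite !cosD !sinD; have := sin2cos2 x; move: (sin x) (cos x) => s c h.
have -> : (c * c - s * s) * c - (s * c + c * s) * s = c ^+ 3 - 3 * s ^+ 2 * c.
  by ring.
by rewrite h; ring.
Qed.

Lemma cos_pi3 {R : realType} : cos (pi / 3) = 1 / 2 :> R.
Proof.
have p0 := @pi_gt0 R.
have c0 : 0 < cos (pi / 3 : R) by apply: cos_gt0_pihalf; lra.
have := cos_triple (pi / 3 : R).
have -> : 3 * (pi / 3) = pi :> R by field.
rewrite cospi; move: (cos _) c0 => c c0 h.
have : (c + 1) * (2 * c - 1) ^+ 2 = 0 by lra.
by move/eqP; rewrite mulf_eq0 sqrf_eq0 => /orP[] /eqP ?; lra.
Qed.

Lemma cos_ge_half {R : realType} (t : R) : `|t| <= pi / 3 -> 1 / 2 <= cos t.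
Proof.
by move=> ht; rewrite -cos_pi3 le_cos_norm//; have := @pi_gt0 R; lra.
Qed.

Lemma cos_turn_lt1 {R : realType} (k : nat) :
  (2 <= k)%N -> cos (2 * pi / k%:R) < 1 :> R.
Proof.
move=> k2; have p0 := @pi_gt0 R.
have k2R : 2 <= k%:R :> R by rewrite ler_nat.
have a0 : 0 < 2 * pi / k%:R :> R by rewrite divr_gt0//; lra.
have api : 2 * pi / k%:R <= pi :> R by rewrite ler_pdivrMr; nra.
by rewrite -[ltRHS]cos0 ltr_cos// in_itv/= ?lexx ?pi_ge0// ltW.
Qed.

Lemma cos_third_turn {R : realType} : cos (2 * pi / 3) = - (1 / 2) :> R.
Proof. by rewrite -mulrA cos_double cos_pi3; lra. Qed.

(** The angle [x = 2 pi / 5] satisfies [cos (3 x) = cos (2 x)], which is a cubic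
    equation for [cos x]; removing its root 1 leaves [4 c^2 + 2 c - 1 = 0],
    whose roots are below [1/3]. *)
Lemma cos_fifth_turn_lt {R : realType} : cos (2 * pi / 5) < 1 / 3 :> R.
Proof.
set x : R := 2 * pi / 5; have c1 : cos x < 1 by exact: cos_turn_lt1.
have : cos (3 * x) = cos (2 * x).
  have -> : 3 * x = - (2 * x) + pi *+ 2 by rewrite -mulr_natl /x; field.
  by rewrite cosD2pi cosN.
rewrite cos_triple cos_double; move: (cos x) c1 => c c1 h.
have : (c - 1) * (4 * c ^+ 2 + 2 * c - 1) = 0 by lra.
move/eqP; rewrite mulf_eq0 => /orP[] /eqP h'; first lra.
by nra.
Qed.

(** By the double angle formula, since [cos (2 pi / k) >= cos (pi / 3)]. *)
Lemma cos_sqr_half_turn {R : realType} (k : nat) : (6 <= k)%N ->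
  3 / 4 <= cos (pi / k%:R) ^+ 2 :> R.
Proof.
move=> k6; have p0 := @pi_gt0 R; have k6R : 6 <= k%:R :> R by rewrite ler_nat.
have : 1 / 2 <= cos (2 * (pi / k%:R)) :> R.
  apply: cos_ge_half; rewrite ger0_norm; last by rewrite mulr_ge0// divr_ge0; lra.
  by rewrite mulrA ler_pdivrMr; nra.
by rewrite cos_double; lra.
Qed.

Lemma unit_vector_angle {R : realType} (a b : R) : a ^+ 2 + b ^+ 2 = 1 ->
  exists t, [/\ 0 <= t, t <= 2 * pi, a = cos t & b = sin t].
Proof.
move=> ab1; have p0 := @pi_gt0 R.
have a1 : -1 <= a <= 1 by have := sqr_ge0 b; nra.
have ca : cos (acos a) = a by apply: acosK; rewrite in_itv.
have sa : sin (acos a) = `|b|.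
  by rewrite sin_acos// -sqrtr_sqr; congr Num.sqrt; lra.
have [la ua] := (acos_ge0 a1, acos_lepi a1).
have [b0|b0] := leP 0 b.
  by exists (acos a); split; rewrite ?ca ?sa ?ger0_norm//; lra.
exists (- acos a + pi *+ 2).
rewrite cosD2pi sinD2pi cosN sinN ca sa ltr0_norm// opprK -mulr_natl.
by split=> //; lra.
Qed.

(** * Euclidean distance and rotations *)

Lemma edist_sqr {R : realType} (x y : R * R) :
  edist x y ^+ 2 = (x.1 - y.1) ^+ 2 + (x.2 - y.2) ^+ 2.
Proof. by rewrite sqr_sqrtr// addr_ge0// sqr_ge0. Qed.

Lemma edist_ge0 {R : realType} (x y : R * R) : 0 <= edist x y.
Proof. exact: sqrtr_ge0. Qed.

Lemma edist_gt0 {R : realType} (x y : R * R) : x <> y -> 0 < edist x y.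
Proof.
move=> xy; rewrite lt_neqAle edist_ge0 andbT; apply/eqP => xy0; apply: xy.
have := edist_sqr x y; rewrite -xy0 expr0n /=; case: x y {xy0} => [a b] [c d] /=.
move=> h; have := sqr_ge0 (a - c); have := sqr_ge0 (b - d) => h1 h2.
by congr pair; apply/eqP; rewrite -subr_eq0 -sqrf_eq0; apply/eqP; lra.
Qed.

Lemma ler_edist_cst {R : realType} (x y : R * R) (r : R) : 0 <= r ->
  (edist x y <= r) = ((x.1 - y.1) ^+ 2 + (x.2 - y.2) ^+ 2 <= r ^+ 2).
Proof. by move=> r0; rewrite -edist_sqr ler_sqr ?nnegrE ?edist_ge0. Qed.

Lemma ltr_edist_cst {R : realType} (x y : R * R) (r : R) : 0 <= r ->
  (edist x y < r) = ((x.1 - y.1) ^+ 2 + (x.2 - y.2) ^+ 2 < r ^+ 2).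
Proof. by move=> r0; rewrite -edist_sqr ltr_sqr ?nnegrE ?edist_ge0. Qed.

(** Cauchy-Schwarz in the plane, with [m] and [n] the norms of the two vectors. *)
Lemma dot_le_norms {R : realType} (a b c d m n : R) : 0 <= m -> 0 <= n ->
  a ^+ 2 + b ^+ 2 = m ^+ 2 -> c ^+ 2 + d ^+ 2 = n ^+ 2 -> a * c + b * d <= m * n.
Proof.
move=> m0 n0 hm hn; rewrite -[leRHS]ger0_norm ?mulr_ge0//.
apply: (le_trans (ler_norm _)); rewrite -ler_sqr ?nnegrE ?normr_ge0//.
rewrite !real_normK ?num_real// exprMn -hm -hn -subr_ge0.
by have := sqr_ge0 (a * d - b * c); congr (_ <= _); ring.
Qed.

Lemma edist_triangle {R : realType} (x y z : R * R) :
  edist x z <= edist x y + edist y z.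
Proof.
have [exy eyz] := (edist_ge0 x y, edist_ge0 y z).
rewrite ler_edist_cst ?addr_ge0//.
have := dot_le_norms exy eyz (esym (edist_sqr x y)) (esym (edist_sqr y z)).
by have := edist_sqr x y; have := edist_sqr y z; nra.
Qed.

Lemma rotation0 {R : realType} (p y : R * R) : rotation p 0 y = y.
Proof. by case: y => y1 y2; rewrite /rotation cos0 sin0/=; congr pair; ring. Qed.

Lemma rotationD {R : realType} (p : R * R) (s t : R) (y : R * R) :
  rotation p s (rotation p t y) = rotation p (s + t) y.
Proof. by rewrite /rotation cosD sinD/=; congr pair; ring. Qed.

Lemma rotation_center {R : realType} (p : R * R) (t : R) : rotation p t p = p.
Proof. by case: p => p1 p2; rewrite /rotation/=; congr pair; ring. Qed.

Lemma rotation_isometry {R : realType} (p : R * R) (t : R) (y z : R * R) :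
  edist (rotation p t y) (rotation p t z) = edist y z.
Proof.
rewrite /edist; congr Num.sqrt => /=.
have := sin2cos2 t; move: (sin t) (cos t) => s c h.
transitivity ((s ^+ 2 + c ^+ 2) * ((y.1 - z.1) ^+ 2 + (y.2 - z.2) ^+ 2)).
  by ring.
by rewrite h subrK mul1r.
Qed.

(** * Invariance under rotations and uniqueness of the center *)

Definition turn_invariant {R : realType} (C : set (R * R)) (p : R * R) (t : R) :=
  forall y, C (rotation p t y) <-> C y.

Lemma rotation_image_invariant {R : realType} (C : set (R * R)) (p : R * R)
  (t : R) : rotation p t @` C = C <-> turn_invariant C p t.
Proof.
split=> [CE y|inv]; last first.
  rewrite eqEsubset; split=> [_ [y Cy <-]|y Cy]; first exact/inv.
  exists (rotation p (- t) y); last by rewrite rotationD subrr rotation0.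
  by apply/inv; rewrite rotationD subrr rotation0.
split=> [|Cy]; last by rewrite -CE; exists y.
rewrite -{1}CE => -[z Cz] /(congr1 (rotation p (- t))).
by rewrite !rotationD addNr !rotation0 => <-.
Qed.

Lemma turn_invariantD {R : realType} (C : set (R * R)) (p : R * R) (s t : R) :
  turn_invariant C p s -> turn_invariant C p t -> turn_invariant C p (s + t).
Proof. by move=> hs ht y; rewrite -rotationD hs ht. Qed.

Lemma turn_invariantN {R : realType} (C : set (R * R)) (p : R * R) (t : R) :
  turn_invariant C p t -> turn_invariant C p (- t).
Proof. by move=> ht y; rewrite -ht rotationD subrr rotation0. Qed.

Lemma turn_invariantMn {R : realType} (C : set (R * R)) (p : R * R) (t : R)
  (n : nat) : turn_invariant C p t -> turn_invariant C p (n%:R * t).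
Proof.
move=> ht; elim: n => [|n IH]; first by move=> y; rewrite mul0r rotation0.
by rewrite -natr1 mulrDl mul1r; exact: turn_invariantD.
Qed.

(** A Bezout relation [u k - v l = gcd k l], divided by [k l], writes the angle
    [2 pi / lcm k l] as [u (2 pi / l) - v (2 pi / k)]. *)
Lemma turn_invariant_lcm {R : realType} (C : set (R * R)) (p : R * R)
  (k l : nat) : (0 < k)%N -> (0 < l)%N ->
  turn_invariant C p (2 * pi / k%:R) -> turn_invariant C p (2 * pi / l%:R) ->
  turn_invariant C p (2 * pi / (lcmn k l)%:R).
Proof.
move=> k0 l0 Ck Cl; have [u v uv _] := egcdnP l k0.
have kR : k%:R != 0 :> R by rewrite pnatr_eq0 -lt0n.
have lR : l%:R != 0 :> R by rewrite pnatr_eq0 -lt0n.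
have mR : (lcmn k l)%:R != 0 :> R by rewrite pnatr_eq0 -lt0n lcmn_gt0 k0.
have gR : (lcmn k l)%:R * (gcdn k l)%:R = k%:R * l%:R :> R.
  by rewrite -!natrM muln_lcm_gcd.
have uvR : u%:R * k%:R = v%:R * l%:R + (gcdn k l)%:R :> R.
  by rewrite -!natrM uv natrD.
have -> : 2 * pi / (lcmn k l)%:R =
    u%:R * (2 * pi / l%:R) + - (v%:R * (2 * pi / k%:R)) :> R.
  have gE : (gcdn k l)%:R = u%:R * k%:R - v%:R * l%:R :> R by rewrite uvR; ring.
  have -> : u%:R * (2 * pi / l%:R) - v%:R * (2 * pi / k%:R) =
      2 * pi * (gcdn k l)%:R / (k%:R * l%:R) :> R.
    by rewrite gE; field; rewrite kR lR.
  rewrite -gR.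
  have g0 : (gcdn k l)%:R != 0 :> R by rewrite pnatr_eq0 -lt0n gcdn_gt0 k0.
  by field; rewrite g0 mR.
by apply: turn_invariantD; [|apply: turn_invariantN]; exact: turn_invariantMn.
Qed.

Lemma le0_bounded_multiples {R : realType} (a M : R) :
  (forall n : nat, n%:R * a <= M) -> a <= 0.
Proof.
move=> h; rewrite leNgt; apply/negP => a0.
have := h (Num.truncn (M / a)).+1.
by rewrite leNgt -ltr_pdivrMr// truncnS_gt.
Qed.

(** A coordinatewise bound, so that translations and Euclidean distances can
    both be compared with it directly. *)
Definition plane_bounded {R : realType} (C : set (R * R)) :=
  exists M : R, forall y, C y -> `|y.1| <= M /\ `|y.2| <= M.

Lemma compact_plane_bounded {R : realType} (C : set (R * R)) :
  compact C -> plane_bounded C.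
Proof.
move=> /compact_bounded [M [_ hM]]; exists (M + 1) => y Cy.
by apply/andP; rewrite -ge_max -prod_normE; apply: hM => //; rewrite ltrDl.
Qed.

Lemma bounded_no_translation {R : realType} (C : set (R * R)) (w : R * R) :
  plane_bounded C -> C !=set0 -> (forall y, C y -> C (y.1 + w.1, y.2 + w.2)) ->
  w = (0, 0).
Proof.
move=> [M hM] [y Cy] hw.
have step n : C (y.1 + n%:R * w.1, y.2 + n%:R * w.2).
  elim: n => [|n IH]; first by rewrite !mul0r !addr0; case: y Cy.
  have := hw _ IH; rewrite -natr1 /= => h; congr (C _): h; congr pair; ring.
have small (a b : R) : `|a| <= M -> (forall n : nat, `|a + n%:R * b| <= M) -> b = 0.
  move=> aM h; apply/eqP; rewrite eq_le; apply/andP; split.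
    apply: (@le0_bounded_multiples _ _ (2 * M)) => n.
    by have := h n; rewrite !ler_norml in aM *; lra.
  rewrite -oppr_le0; apply: (@le0_bounded_multiples _ _ (2 * M)) => n.
  by have := h n; rewrite !ler_norml in aM *; lra.
case: w step {hw} => w1 w2 /= step; have [y1 y2] := hM _ Cy.
by congr pair; [apply: small y1 _ => n | apply: small y2 _ => n];
  have [] := hM _ (step n).
Qed.

(** With [A] and [B] the linear parts of the two rotations, exchanging the order
    of composition changes the result by the translation of vector
    [(1 - A)(1 - B)(p - q)]. It maps [C] into itself, so it vanishes; and
    [1 - A], [1 - B] are invertible because
    [det (1 - A) = 2 (1 - cos s)] is nonzero. *)
Lemma center_unique {R : realType} (C : set (R * R)) (p q : R * R) (s t : R) :
  plane_bounded C -> C !=set0 -> cos s < 1 -> cos t < 1 ->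
  turn_invariant C p s -> turn_invariant C q t -> p = q.
Proof.
move=> Cb C0 s1 t1 Cs Ct.
pose w : R * R :=
  ((rotation p s (rotation q t p)).1 - (rotation q t (rotation p s p)).1,
   (rotation p s (rotation q t p)).2 - (rotation q t (rotation p s p)).2).
have w0 : w = (0, 0).
  apply: (bounded_no_translation Cb C0) => y Cy.
  set y' := rotation p (- s) (rotation q (- t) y).
  have Cy' : C y' by apply/(turn_invariantN Cs)/(turn_invariantN Ct).
  have -> : (y.1 + w.1, y.2 + w.2) = rotation p s (rotation q t y').
    have {1 2}-> : y = rotation q t (rotation p s y').
      by rewrite !rotationD !(subrr, rotationD, rotation0).
    by rewrite /w /rotation/=; congr pair; ring.
  by apply/Cs/Ct.
case: w0; rewrite /rotation/=.
have := sin2cos2 s; have := sin2cos2 t.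
move: (sin s) (cos s) (sin t) (cos t) s1 t1 => a b c d b1 d1 hc ha e1 e2.
case: p q {Cs Ct w} e1 e2 => [p1 p2] [q1 q2]/= e1 e2.
have h : (2 - 2 * b) * (2 - 2 * d) * ((p1 - q1) ^+ 2 + (p2 - q2) ^+ 2) = 0.
  transitivity (((1 - b) ^+ 2 + a ^+ 2) * ((1 - d) ^+ 2 + c ^+ 2) *
     ((p1 - q1) ^+ 2 + (p2 - q2) ^+ 2)); first by rewrite ha hc; ring.
  set A := LHS; have -> : A = 0 ^+ 2 + 0 ^+ 2; last by rewrite expr0n/= addr0.
  by rewrite -{1}e1 -e2 /A; ring.
move/eqP: h; rewrite mulf_eq0 => /orP[/eqP h|/eqP h]; first by exfalso; nra.
by congr pair; apply/eqP; rewrite -subr_eq0 -sqrf_eq0; apply/eqP;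
  have := sqr_ge0 (p1 - q1); have := sqr_ge0 (p2 - q2); lra.
Qed.

Lemma center_turn_invariant {R : realType} (C : set (R * R)) (p q : R * R)
  (k l : nat) : compact C -> (2 <= k)%N -> (2 <= l)%N ->
  center_of_symmetry C k p -> center_of_symmetry C l q ->
  q = p /\ turn_invariant C p (2 * pi / l%:R).
Proof.
move=> Ccomp k2 l2 [Cp /rotation_image_invariant Ck].
move=> [_ /rotation_image_invariant Cl].
suff qp : q = p by rewrite qp in Cl.
apply: (center_unique (compact_plane_bounded Ccomp) _ _ _ Cl Ck);
  by [exists p | exact: cos_turn_lt1].
Qed.

(** * Interior points and convexity *)

Lemma normr_lt_sqr {R : realType} (a e : R) : 0 <= e ->
  (`|a| < e) = (a ^+ 2 < e ^+ 2).
Proof. by move=> e0; rewrite -(real_normK (num_real a)) ltr_sqr ?nnegrE. Qed.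

(** The topology of [R * R] comes from the max norm, but Euclidean disks form a
    basis of neighborhoods as well. *)
Lemma interior_edistP {R : realType} (C : set (R * R)) (x : R * R) :
  interior C x <-> exists2 e : R, 0 < e & forall y, edist x y < e -> C y.
Proof.
split=> [/nbhs_normP[e /= e0 h]|[e e0 h]].
  exists e => // y xy; apply: h => /=; rewrite prod_normE gt_max /=.
  move: xy; rewrite ltr_edist_cst ?ltW// => xy.
  rewrite !normr_lt_sqr ?ltW//; have := sqr_ge0 (x.1 - y.1).
  by have := sqr_ge0 (x.2 - y.2); lra.
suff : nbhs_ball_ (ball_ Num.norm) x C by move/nbhs_normP.
exists (e / 2) => /=; first by rewrite divr_gt0.
move=> y /=; rewrite prod_normE gt_max /= => /andP[h1 h2]; apply: h.
rewrite ltr_edist_cst ?ltW//.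
have e20 : 0 <= e / 2 by rewrite divr_ge0 ?ltW.
move: h1 h2; rewrite !normr_lt_sqr//.
nra.
Qed.

Lemma closure_edist {R : realType} (C : set (R * R)) (x : R * R) :
  (forall e : R, 0 < e -> exists2 y, C y & edist x y < e) -> closure C x.
Proof.
move=> h B /interior_edistP[e e0 Be]; have [y Cy xy] := h _ e0.
by exists y; split=> //; exact: Be.
Qed.

Lemma convex_set_segment {R : realType} (C : set (R * R)) (x y : R * R) (l : R) :
  convex_set C -> C x -> C y -> 0 <= l <= 1 ->
  C (l * x.1 + (1 - l) * y.1, l * x.2 + (1 - l) * y.2).
Proof.
move=> Cconv Cx Cy /andP[l0 l1].
by have := Cconv x y (Itv01 l0 l1); rewrite !inE; apply.
Qed.

Lemma convex_set_average {R : realType} (C : set (R * R)) (f : nat -> R * R)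
  (n : nat) : convex_set C -> (forall j, C (f j)) ->
  C ((\sum_(0 <= j < n.+1) (f j).1) / n.+1%:R,
     (\sum_(0 <= j < n.+1) (f j).2) / n.+1%:R).
Proof.
move=> Cconv Cf; elim: n => [|n IH].
  by rewrite !big_nat1 !divr1; case: (f 0%N) (Cf 0%N).
have n1 : n.+1%:R != 0 :> R by rewrite pnatr_eq0.
have l01 : 0 <= (n.+1%:R : R) / n.+2%:R <= 1.
  by apply/andP; split; [rewrite divr_ge0|rewrite ler_pdivrMr ?ltr0n// mul1r ler_nat].
have := convex_set_segment Cconv IH (Cf n.+1) l01.
rewrite (big_nat_recr n.+1)//= [in X in _ -> X](big_nat_recr n.+1)//=.
move: (\sum_(_ <= _ < _) _) (\sum_(_ <= _ < _) _) => S1 S2; congr (C _).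
have n2 : n.+1%:R + 1 != 0 :> R by rewrite natr1 pnatr_eq0.
rewrite -(natr1 n.+1); move: (n.+1%:R) n1 n2 => m m0 m1.
by congr pair; field; rewrite m0 m1.
Qed.

(** The homothety of center [x] and ratio [1 - l] carries a disk in [C] about [y]
    to a disk in [C] about the point of the segment. *)
Lemma interior_open_segment {R : realType} (C : set (R * R)) (x y : R * R)
  (l : R) : convex_set C -> C x -> interior C y -> 0 <= l < 1 ->
  interior C (l * x.1 + (1 - l) * y.1, l * x.2 + (1 - l) * y.2).
Proof.
move=> Cconv Cx /interior_edistP[e e0 Ce] /andP[l0 l1].
have d0 : 0 < 1 - l by lra.
apply/interior_edistP; exists ((1 - l) * e); first by rewrite mulr_gt0.
move=> z; rewrite ltr_edist_cst; last by rewrite mulr_ge0// ltW.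
move=> /= zx.
have rescale (a b c : R) : (l * a + (1 - l) * b - c) ^+ 2 =
    (1 - l) ^+ 2 * (b - (c - l * a) / (1 - l)) ^+ 2.
  by field; exact: lt0r_neq0.
move: zx; rewrite !rescale -mulrDr exprMn ltr_pM2l ?exprn_gt0// => zx.
pose y' := ((z.1 - l * x.1) / (1 - l), (z.2 - l * x.2) / (1 - l)).
have Cy' : C y' by apply: Ce; rewrite ltr_edist_cst ?ltW.
have -> : z = (l * x.1 + (1 - l) * y'.1, l * x.2 + (1 - l) * y'.2).
  rewrite /y' [LHS]surjective_pairing /=.
  by congr pair; field; exact: lt0r_neq0.
by apply: convex_set_segment => //; rewrite l0 ltW.
Qed.

(** The two sums are the coordinates of the sum of an orbit of a vector under a
    rotation of finite order. That vector is fixed by the rotation (the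
    differences of consecutive terms telescope), hence null. *)
Lemma sum_orbit_eq0 {R : realType} (k : nat) (v : R * R) (t : R) :
  cos t < 1 -> cos (k%:R * t) = 1 -> sin (k%:R * t) = 0 ->
  \sum_(0 <= j < k) (cos (j%:R * t) * v.1 - sin (j%:R * t) * v.2) = 0 /\
  \sum_(0 <= j < k) (sin (j%:R * t) * v.1 + cos (j%:R * t) * v.2) = 0.
Proof.
move=> t1 ck sk.
set f := fun j : nat => cos (j%:R * t) * v.1 - sin (j%:R * t) * v.2.
set g := fun j : nat => sin (j%:R * t) * v.1 + cos (j%:R * t) * v.2.
rewrite -/(\sum_(0 <= j < k) f j) -/(\sum_(0 <= j < k) g j).
have fS j : f j.+1 - f j = (cos t - 1) * f j - sin t * g j.
  by rewrite /f /g -natr1 mulrDl mul1r cosD sinD; ring.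
have gS j : g j.+1 - g j = sin t * f j + (cos t - 1) * g j.
  by rewrite /f /g -natr1 mulrDl mul1r cosD sinD; ring.
have := telescope_sumr f (leq0n k); have := telescope_sumr g (leq0n k).
have -> : f k - f 0%N = 0 by rewrite /f ck sk (mul0r t) cos0 sin0 subrr.
have -> : g k - g 0%N = 0 by rewrite /g ck sk (mul0r t) cos0 sin0 subrr.
under eq_bigr do rewrite gS; under [in X in _ -> X -> _]eq_bigr do rewrite fS.
rewrite sumrB big_split/= -!mulr_sumr.
move: (\sum_(_ <= _ < _) _) (\sum_(_ <= _ < _) _) => G F eG eF.
have d0 : (cos t - 1) ^+ 2 + sin t ^+ 2 != 0.
  by rewrite lt0r_neq0//; have := sqr_ge0 (sin t); nra.
split; apply: (mulfI d0); rewrite mulr0.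
  transitivity ((cos t - 1) * ((cos t - 1) * F - sin t * G) +
    sin t * (sin t * F + (cos t - 1) * G)); first by ring.
  by rewrite eF eG !mulr0 addr0.
transitivity ((cos t - 1) * (sin t * F + (cos t - 1) * G) -
  sin t * ((cos t - 1) * F - sin t * G)); first by ring.
by rewrite eF eG !mulr0 subr0.
Qed.

(** The center is the average of the orbit of any point of [C]; taking an
    interior point, every [w] close to [p] is the average of the orbit
    translated by [w - p], which remains in [C]. *)
Lemma interior_center {R : realType} (C : set (R * R)) (p : R * R) (k : nat) :
  convex_set C -> interior C !=set0 -> (2 <= k)%N ->
  turn_invariant C p (2 * pi / k%:R) -> interior C p.
Proof.
move=> Cconv [z /interior_edistP[e e0 Ce]] k2; set t := 2 * pi / k%:R => Ct.
have t1 : cos t < 1 by exact: cos_turn_lt1.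
have kR : k%:R != 0 :> R by rewrite pnatr_eq0; case: k k2 {t Ct t1}.
have kt : k%:R * t = pi *+ 2 by rewrite /t mulrCA divff// mulr1 mulr_natl.
apply/interior_edistP; exists e => // w pw.
pose v := (z.1 - p.1, z.2 - p.2).
pose f (j : nat) : R * R :=
  (w.1 + (cos (j%:R * t) * v.1 - sin (j%:R * t) * v.2),
   w.2 + (sin (j%:R * t) * v.1 + cos (j%:R * t) * v.2)).
have Cf j : C (f j).
  apply/(turn_invariantN (turn_invariantMn j Ct))/Ce.
  rewrite -(rotation_isometry p (j%:R * t)) rotationD subrr rotation0.
  congr (_ < e): pw; rewrite /edist /f /v /rotation /=.
  by congr (Num.sqrt (_ ^+ 2 + _ ^+ 2)); ring.
have [sum1 sum2] : \sum_(0 <= j < k) (f j).1 = k%:R * w.1 /\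
    \sum_(0 <= j < k) (f j).2 = k%:R * w.2.
  have [||s1 s2] := @sum_orbit_eq0 _ k v _ t1; rewrite ?kt ?cos2pi ?sin2pi//.
  by split; rewrite big_split/= ?s1 ?s2 addr0 sumr_const_nat subn0 mulr_natl.
have := convex_set_average k.-1 Cconv Cf; rewrite (ltn_predK k2) sum1 sum2.
by rewrite ![k%:R * _]mulrC !mulfK//; case: w {pw f Cf sum1 sum2}.
Qed.

(** * The disk of closest boundary points and its supporting lines *)

(** On the segment from [p] to [y], the last point in the closure of [C] is [y]
    itself and is interior to [C]: otherwise it would be a boundary point closer
    to [p] than [r]. *)
Lemma ball_sub_closest {R : realType} (C : set (R * R)) (p : R * R) (r : R) :
  C p -> (forall x, boundary C x -> r <= edist p x) ->
  forall y, edist p y < r -> C y.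
Proof.
move=> Cp hr y pyr.
have r0 : 0 < r by exact: le_lt_trans (edist_ge0 _ _) pyr.
pose pt (l : R) : R * R := (p.1 + l * (y.1 - p.1), p.2 + l * (y.2 - p.2)).
have dpt l m : edist (pt l) (pt m) = `|l - m| * edist p y.
  apply/eqP; rewrite -(@eqrXn2 _ 2) ?mulr_ge0 ?edist_ge0//; apply/eqP.
  by rewrite exprMn !edist_sqr real_normK ?num_real//=; ring.
have pt0 : pt 0 = p by rewrite /pt !mul0r !addr0; case: (p).
have pt1 : pt 1 = y by rewrite /pt !mul1r !subrKC; case: (y).
have dlt l m e : 0 < e -> `|l - m| < e / r -> edist (pt l) (pt m) < e.
  move=> e0; rewrite dpt ltr_pdivlMr//; apply: le_lt_trans.
  by rewrite ler_wpM2l// ltW.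
pose S := [set l : R | 0 <= l <= 1 /\ C (pt l)].
have S0 : S 0 by rewrite /S/= lexx ler01 pt0.
have Sb : has_ubound S by exists 1 => l [/andP[_ ]].
have Ss : has_sup S by split=> //; exists 0.
have m0 : 0 <= sup S by exact: ub_le_sup.
have m1 : sup S <= 1 by apply: ge_sup; [exists 0 | move=> l [/andP[]]].
have clm : closure C (pt (sup S)).
  apply: closure_edist => e e0.
  have [l Sl ml] := sup_adherent (divr_gt0 e0 r0) Ss.
  exists (pt l); first by case: Sl.
  have lm : l <= sup S by exact: ub_le_sup.
  by apply: dlt => //; rewrite ger0_norm; lra.
have pm : edist p (pt (sup S)) < r.
  apply: le_lt_trans pyr; rewrite -{1}pt0 dpt sub0r normrN ger0_norm//.
  by rewrite ler_piMl ?edist_ge0.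
have [/interior_edistP[e e0 Ce]|nint] := pselect (interior C (pt (sup S))).
  have [m1'|m1'] := eqVneq (sup S) 1.
    by rewrite -pt1 -m1'; apply: Ce; rewrite dpt subrr normr0 mul0r.
  have d0 : 0 < e / r by rewrite divr_gt0.
  pose l := Num.min 1 (sup S + e / r / 2).
  have ml : sup S < l by rewrite lt_min lt_neqAle m1' m1/=; lra.
  have lu : l <= sup S + e / r / 2 by rewrite ge_min lexx orbT.
  have : l <= sup S.
    apply: ub_le_sup => //; split; first by rewrite ge_min lexx/= andbT; lra.
    by apply: Ce; apply: dlt => //; rewrite distrC ger0_norm; lra.
  by rewrite leNgt ml.
by have := hr _ (conj clm nint); rewrite leNgt pm.
Qed.

Lemma interior_ball {R : realType} (C : set (R * R)) (p : R * R) (r : R) :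
  (forall y, edist p y < r -> C y) -> forall y, edist p y < r -> interior C y.
Proof.
move=> Cr y py; apply/interior_edistP; exists (r - edist p y).
  by rewrite subr_gt0.
by move=> z yz; apply: Cr; apply: le_lt_trans (edist_triangle p y z) _; lra.
Qed.

Lemma center_neq_closest {R : realType} (C : set (R * R)) (p x : R * R) :
  interior C p -> closest_boundary_point C p x -> p <> x.
Proof. by move=> pint [[_ nint] _] px; apply: nint; rewrite -px. Qed.

(** If [y] lay beyond the tangent at [x] to the disk of center [p] through [x],
    then prolonging the segment from [y] to [x] slightly past [x] would enter
    the open disk, which is interior to [C]; so [x] would be interior. *)
Lemma closest_supporting_line {R : realType} (C : set (R * R)) (p x y : R * R) :
  convex_set C -> interior C p -> closest_boundary_point C p x -> C y ->
  (y.1 - p.1) * (x.1 - p.1) + (y.2 - p.2) * (x.2 - p.2) <= edist p x ^+ 2.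
Proof.
move=> Cconv pint xcl Cy; rewrite leNgt; apply/negP => out.
have ballC z : edist p z < edist p x -> interior C z.
  apply: interior_ball => {z}; apply: ball_sub_closest => [|z bz].
    exact: interior_subset pint.
  exact: xcl.2.
pose D := (y.1 - p.1) * (x.1 - p.1) + (y.2 - p.2) * (x.2 - p.2) - edist p x ^+ 2.
have D0 : 0 < D by rewrite subr_gt0.
pose Y := edist p y ^+ 2; have Y0 : 0 <= Y by exact: sqr_ge0.
(* Small enough that [l * Y < D], which puts [a] below inside the disk. *)
pose l := D / (Y + D + 1).
have den0 : 0 < Y + D + 1 by lra.
have l0 : 0 < l by rewrite divr_gt0.
have l1 : l < 1 by rewrite ltr_pdivrMr//; lra.
have lY : l * Y < D.
  by rewrite /l mulrAC ltr_pdivrMr// ltr_pM2l//; lra.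
have [d0 d1] : 0 < 1 - l /\ 1 - l != 0 by split; [|apply: lt0r_neq0]; lra.
(* The point past [x] such that [x] divides the segment [y a] in ratio [l]. *)
pose a : R * R := ((x.1 - l * y.1) / (1 - l), (x.2 - l * y.2) / (1 - l)).
have aint : interior C a.
  apply: ballC; rewrite ltr_edist_cst ?edist_ge0//.
  rewrite -(ltr_pM2l (exprn_gt0 2 d0)).
  have -> : (1 - l) ^+ 2 * ((p.1 - a.1) ^+ 2 + (p.2 - a.2) ^+ 2) =
      (p.1 - x.1) ^+ 2 + (p.2 - x.2) ^+ 2 +
      l ^+ 2 * ((p.1 - y.1) ^+ 2 + (p.2 - y.2) ^+ 2) -
      2 * l * ((y.1 - p.1) * (x.1 - p.1) + (y.2 - p.2) * (x.2 - p.2)).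
    by rewrite /a/=; field.
  rewrite -!edist_sqr -/Y.
  have -> : (y.1 - p.1) * (x.1 - p.1) + (y.2 - p.2) * (x.2 - p.2) =
    D + edist p x ^+ 2 by rewrite subrK.
  have := sqr_ge0 (edist p x); move: (edist p x ^+ 2) => r r0; nra.
apply: xcl.1.2.
have -> : x = (l * y.1 + (1 - l) * a.1, l * y.2 + (1 - l) * a.2).
  by rewrite /a [LHS]surjective_pairing/=; congr pair; field.
by apply: interior_open_segment; rewrite ?(ltW l0).
Qed.

(** * Polar coordinates and the pieces of a standard partition *)

(** The pieces of a standard partition are described in these coordinates: angle
    measured from the ray [p x], radius in units of the distance [edist p x]. *)
Definition polar_point {R : realType} (p x : R * R) (s t : R) : R * R :=
  rotation p t (p + s *: (x - p)).

Lemma polar_pointE {R : realType} (p x : R * R) (s t : R) :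
  polar_point p x s t =
  (p.1 + s * (cos t * (x.1 - p.1) - sin t * (x.2 - p.2)),
   p.2 + s * (sin t * (x.1 - p.1) + cos t * (x.2 - p.2))).
Proof.
rewrite /polar_point /rotation.
have -> : p + s *: (x - p) = (p.1 + s * (x.1 - p.1), p.2 + s * (x.2 - p.2)).
  by [].
by congr pair => /=; ring.
Qed.

(** The law of cosines. *)
Lemma edist_polar_sqr {R : realType} (p x : R * R) (s t s' t' : R) :
  edist (polar_point p x s t) (polar_point p x s' t') ^+ 2 =
  (s ^+ 2 + s' ^+ 2 - 2 * s * s' * cos (t - t')) * edist p x ^+ 2.
Proof.
rewrite !edist_sqr !polar_pointE/= cosB.
have := sin2cos2 t; have := sin2cos2 t'.
move: (sin t) (cos t) (sin t') (cos t') => a b c d hc ha.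
transitivity ((s ^+ 2 * (a ^+ 2 + b ^+ 2) + s' ^+ 2 * (c ^+ 2 + d ^+ 2)
  - 2 * s * s' * (b * d + a * c)) * ((p.1 - x.1) ^+ 2 + (p.2 - x.2) ^+ 2)).
  by ring.
by rewrite ha hc !subrK !mulr1.
Qed.

Lemma polar_point0 {R : realType} (p x : R * R) (t : R) : polar_point p x 0 t = p.
Proof. by rewrite /polar_point scale0r addr0 rotation_center. Qed.

Lemma polar_point1 {R : realType} (p x : R * R) (t : R) :
  polar_point p x 1 t = rotation p t x.
Proof. by rewrite /polar_point scale1r subrKC. Qed.

Lemma edist_center_polar {R : realType} (p x : R * R) (s t : R) : 0 <= s ->
  edist p (polar_point p x s t) = s * edist p x.
Proof.
move=> s0; apply/eqP; rewrite -(@eqrXn2 _ 2) ?mulr_ge0 ?edist_ge0//.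
by rewrite -{1}(polar_point0 p x t) edist_polar_sqr exprMn; apply/eqP; ring.
Qed.

Lemma polar_coordinates {R : realType} (p x y : R * R) : p <> x ->
  exists s t, [/\ 0 <= s, 0 <= t, t <= 2 * pi & y = polar_point p x s t].
Proof.
move=> px; have p0 := @pi_gt0 R.
have r0 : 0 < edist p x by exact: edist_gt0.
have [py|/eqP py] := eqVneq p y.
  by exists 0, 0; split=> //; [lra | rewrite polar_point0].
have q0 : 0 < edist p y by exact: edist_gt0.
have [r00 q00] := (lt0r_neq0 r0, lt0r_neq0 q0).
have [hr hq] := (edist_sqr p x, edist_sqr p y).
move: (edist p x) (edist p y) r0 q0 r00 q00 hr hq => r q r0 q0 r00 q00 hr hq.
(* Cosine and sine of the angle from [x - p] to [y - p]. *)
pose a := ((y.1 - p.1) * (x.1 - p.1) + (y.2 - p.2) * (x.2 - p.2)) / (q * r).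
pose b := ((y.2 - p.2) * (x.1 - p.1) - (y.1 - p.1) * (x.2 - p.2)) / (q * r).
have ab1 : a ^+ 2 + b ^+ 2 = 1.
  transitivity (((p.1 - x.1) ^+ 2 + (p.2 - x.2) ^+ 2) *
    ((p.1 - y.1) ^+ 2 + (p.2 - y.2) ^+ 2) / (q ^+ 2 * r ^+ 2)).
    by rewrite /a /b; field; rewrite r00 q00.
  by rewrite -hr -hq; field; rewrite r00 q00.
have [t [t0 t1 at_ bt]] := unit_vector_angle ab1.
exists (q / r), t; split=> //; first by rewrite divr_ge0 ?ltW.
rewrite polar_pointE -at_ -bt /a /b [LHS]surjective_pairing; congr pair.
  transitivity (p.1 + (y.1 - p.1) * ((p.1 - x.1) ^+ 2 + (p.2 - x.2) ^+ 2) / r ^+ 2).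
    by rewrite -hr mulfK ?subrKC// expf_neq0.
  by field; rewrite r00 q00.
transitivity (p.2 + (y.2 - p.2) * ((p.1 - x.1) ^+ 2 + (p.2 - x.2) ^+ 2) / r ^+ 2).
  by rewrite -hr mulfK ?subrKC// expf_neq0.
by field; rewrite r00 q00.
Qed.

Lemma subinterval_index {R : realType} (k : nat) (a t : R) : (0 < k)%N ->
  0 <= t -> t <= k%:R * a ->
  exists i : 'I_k, i%:R * a <= t /\ t <= i.+1%:R * a.
Proof.
case: k => // k _ t0; elim: k => [|k IH] tk.
  by exists ord0; rewrite mul0r.
have [/IH[i hi]|/ltW kt] := leP t (k.+1%:R * a).
  by exists (widen_ord (leqnSn _) i).
by exists ord_max.
Qed.

Lemma standard_pieces_cover {R : realType} (C : set (R * R)) (k : nat)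
  (p x y : R * R) : (0 < k)%N -> p <> x -> C y ->
  exists i : 'I_k, standard_piece C p x i y.
Proof.
move=> k0 px Cy; have [s [t [s0 t0 t1 yE]]] := polar_coordinates y px.
have kR : k%:R != 0 :> R by rewrite pnatr_eq0 -lt0n.
have [|i [it ti]] := @subinterval_index _ k (2 * pi / k%:R) t k0 t0.
  by rewrite mulrCA divff ?mulr1.
exists i; split=> //; exists s, t; split=> //.
  by rewrite (mulrC _ i%:R) -mulrA.
by rewrite (mulrC _ i.+1%:R) -mulrA.
Qed.

(** * Diameters of the pieces *)

Definition circumradius {R : realType} (C : set (R * R)) (p : R * R) : R :=
  sup [set edist p y | y in C].

Lemma bounded_edist {R : realType} (C : set (R * R)) : plane_bounded C ->
  exists M : R, forall y z, C y -> C z -> edist y z <= M.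
Proof.
move=> [M hM]; exists (4 * `|M|) => y z /hM[y1 y2] /hM[z1 z2].
rewrite ler_edist_cst; last by rewrite mulr_ge0.
have := ler_norm M; rewrite !ler_norml in y1 y2 z1 z2.
move: (`|M|) => N MN.
have sq (a b : R) : - M <= a <= M -> - M <= b <= M -> (a - b) ^+ 2 <= 4 * N ^+ 2.
  move=> a1 b1; have n0 : 0 <= N by lra.
  by rewrite -[leRHS](_ : (2 * N) ^+ 2 = _); [nra | ring].
by have := sq _ _ y1 z1; have := sq _ _ y2 z2; nra.
Qed.

Lemma edist_le_circumradius {R : realType} (C : set (R * R)) (p y : R * R) :
  plane_bounded C -> C p -> C y -> edist p y <= circumradius C p.
Proof.
move=> /bounded_edist[M hM] Cp Cy; apply: ub_le_sup; last by exists y.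
by exists M => _ [z Cz <-]; exact: hM.
Qed.

Lemma circumradius_le {R : realType} (C : set (R * R)) (p : R * R) (r : R) :
  C p -> (forall y, C y -> edist p y <= r) -> circumradius C p <= r.
Proof.
by move=> Cp h; apply: ge_sup; [exists (edist p p), p | move=> _ [y Cy <-]; exact: h].
Qed.

Lemma edist_le_diameter {R : realType} (A : set (R * R)) (y z : R * R) :
  plane_bounded A -> A y -> A z -> edist y z <= diameter A.
Proof.
move=> /bounded_edist[M hM] Ay Az; apply: ub_le_sup; last by exists y => //; exists z.
by exists M => _ [u Au [v Av <-]]; exact: hM.
Qed.

Lemma diameter_le {R : realType} (A : set (R * R)) (r : R) : A !=set0 ->
  (forall y z, A y -> A z -> edist y z <= r) -> diameter A <= r.
Proof.
move=> [a Aa] h; apply: ge_sup; first by exists (edist a a), a => //; exists a.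
by move=> _ [y Ay [z Az <-]]; exact: h.
Qed.

Lemma standard_piece_center {R : realType} (C : set (R * R)) (k : nat)
  (p x : R * R) (i : 'I_k) : C p -> standard_piece C p x i p.
Proof.
move=> Cp; split=> //; exists 0, (2 * pi * i%:R / k%:R).
split=> //; last by rewrite [RHS]polar_point0.
by rewrite ler_wpM2r ?invr_ge0 ?ler0n// ler_wpM2l ?ler_nat// mulr_ge0 ?pi_ge0.
Qed.

Lemma standard_piece_bounded {R : realType} (C : set (R * R)) (k : nat)
  (p x : R * R) (i : 'I_k) : plane_bounded C ->
  plane_bounded (standard_piece C p x i).
Proof. by move=> [M hM]; exists M => y [/hM]. Qed.

(** By the law of cosines, with [cos (t - t') >= 1/2]: the side opposite an angle
    at most [pi / 3] is not the strictly longest one. *)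
Lemma narrow_sector_edist {R : realType} (p x : R * R) (s t s' t' r : R) :
  0 <= s -> 0 <= s' -> `|t - t'| <= pi / 3 ->
  edist p (polar_point p x s t) <= r -> edist p (polar_point p x s' t') <= r ->
  edist (polar_point p x s t) (polar_point p x s' t') <= r.
Proof.
move=> s0 s'0 tt'; rewrite !edist_center_polar// => sr s'r.
have d0 := edist_ge0 p x.
have r0 : 0 <= r by apply: le_trans sr; rewrite mulr_ge0.
rewrite -ler_sqr ?nnegrE ?edist_ge0// edist_polar_sqr.
have c2 := cos_ge_half tt'; have ss' : 0 <= s * s' by rewrite mulr_ge0.
have sr2 : (s * edist p x) ^+ 2 <= r ^+ 2 by rewrite ler_sqr ?nnegrE ?mulr_ge0.
have s'r2 : (s' * edist p x) ^+ 2 <= r ^+ 2 by rewrite ler_sqr ?nnegrE ?mulr_ge0.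
have le_sides : s ^+ 2 + s' ^+ 2 - 2 * s * s' * cos (t - t') <= Num.max s s' ^+ 2.
  have : s * s' * (1 - 2 * cos (t - t')) <= 0 by rewrite mulr_ge0_le0//; lra.
  by rewrite /Num.max; case: ltP => h; nra.
apply: le_trans (ler_wpM2r (sqr_ge0 _) le_sides) _.
by rewrite -exprMn /Num.max; case: ltP.
Qed.

(** No piece exceeds the circumradius, being a narrow sector; conversely each
    contains the center, and together they cover [C]. *)
Lemma max_rel_diameter_narrow {R : realType} (C : set (R * R)) (k : nat)
  (P : 'I_k -> set (R * R)) (p x : R * R) : plane_bounded C -> C p -> p <> x ->
  (6 <= k)%N -> (forall i, P i = standard_piece C p x i) ->
  max_rel_diameter P = circumradius C p.
Proof.
move=> Cb Cp px k6 PE; have p0 := @pi_gt0 R.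
have k0 : (0 < k)%N by exact: leq_trans k6.
have k6R : 6 <= k%:R :> R by rewrite ler_nat.
apply/eqP; rewrite eq_le; apply/andP; split.
  apply: bigmax_le => [|i _].
    exact: le_trans (edist_ge0 p p) (edist_le_circumradius Cb Cp Cp).
  rewrite PE; apply: diameter_le; first by exists p; exact: standard_piece_center.
  move=> y z [Cy [s [t [s0 t1 t2 yE]]]] [Cz [s' [t' [s'0 t'1 t'2 zE]]]].
  subst y z.
  have width : 2 * (pi : R) * i.+1%:R / k%:R <= 2 * pi * i%:R / k%:R + pi / 3.
    have : 2 * pi / k%:R <= pi / 3 :> R by rewrite ler_pdivrMr ?ltr0n//; nra.
    have -> : 2 * pi * i.+1%:R / k%:R = 2 * pi * i%:R / k%:R + 2 * pi / k%:R :> R.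
      by rewrite -(natr1 i); ring.
    lra.
  by apply: narrow_sector_edist; rewrite ?ler_norml//;
    [apply/andP; split; lra | | ]; exact: edist_le_circumradius.
apply: circumradius_le => // y Cy.
have [i Piy] := standard_pieces_cover k0 px Cy.
apply: le_trans (le_bigmax _ _ i); rewrite PE.
apply: edist_le_diameter => //; first exact: standard_piece_bounded.
exact: standard_piece_center.
Qed.

(** Every point of [C] makes an angle at most [pi / k] with the ray through some
    image of [x] under the rotations; the supporting line at that image bounds
    its projection on the ray by [edist p x]. *)
Lemma circumradius_cos_le {R : realType} (C : set (R * R)) (p x : R * R)
  (k : nat) : convex_set C -> interior C p -> closest_boundary_point C p x ->
  (3 <= k)%N -> turn_invariant C p (2 * pi / k%:R) ->
  circumradius C p * cos (pi / k%:R) <= edist p x.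
Proof.
move=> Cconv pint xcl k3 Ct; have p0 := @pi_gt0 R.
have k0 : (0 < k)%N by exact: leq_trans k3.
have k3R : 3 <= k%:R :> R by rewrite ler_nat.
have kR : 0 < k%:R :> R by rewrite ltr0n.
have px := center_neq_closest pint xcl.
have halfturn : 2 * pi / k%:R = 2 * (pi / k%:R) :> R by rewrite mulrA.
have w0 : 0 < pi / k%:R :> R by rewrite divr_gt0.
have wk : pi / k%:R <= pi / 3 :> R.
  by rewrite ler_pM2l// lef_pV2 ?posrE//; lra.
have c0 : 0 < cos (pi / k%:R) :> R by apply: cos_gt0_pihalf; lra.
rewrite -ler_pdivlMr//; apply: circumradius_le => [|y Cy].
  exact: interior_subset pint.
have [s [t [s0 t0 t1 yE]]] := polar_coordinates y px; subst y.
have [|i [it ti]] := @subinterval_index _ k (2 * pi / k%:R) t k0 t0.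
  by rewrite mulrCA divff ?mulr1// lt0r_neq0.
(* The nearer of the two multiples of the turn that surround [t]. *)
have [j near_j] : exists j : nat, `|t - j%:R * (2 * pi / k%:R)| <= pi / k%:R.
  rewrite -natr1 halfturn in ti it *.
  have [le_mid|lt_mid] := leP t (i%:R * (2 * (pi / k%:R)) + pi / k%:R).
    by exists i; rewrite ler_norml; apply/andP; split; lra.
  exists i.+1; rewrite -natr1 ler_norml; apply/andP.
  by split; lra.
have Cy' : C (polar_point p x s (- (j%:R * (2 * pi / k%:R)) + t)).
  rewrite /polar_point -rotationD.
  by apply/(turn_invariantN (turn_invariantMn j Ct)).
(* The half-plane bound for the rotated point, written in polar form. *)
have := closest_supporting_line Cconv pint xcl Cy'.
rewrite polar_pointE edist_center_polar//= ler_pdivlMr// edist_sqr.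
rewrite (addrC (- _)); set d := t - _; move: (near_j) => /le_cos_norm.
rewrite -/d; have -> : pi / k%:R <= pi :> R by lra.
move=> /(_ isT) cd sup.
have r0 : 0 < edist p x ^+ 2 by rewrite exprn_gt0// edist_gt0.
have {}sup : s * cos d * edist p x ^+ 2 <= 1 * edist p x ^+ 2.
  by rewrite mul1r edist_sqr; congr (_ <= _): sup; ring.
rewrite ler_pM2r// in sup.
rewrite mulrAC ler_piMl ?edist_ge0//; apply: le_trans sup.
by rewrite ler_wpM2l.
Qed.

(** The left-hand side is the squared distance between [x] and its image under
    the rotation, both of which lie in the first piece. *)
Lemma closest_chord_le {R : realType} (C : set (R * R)) (k : nat)
  (P : 'I_k -> set (R * R)) (p x : R * R) : plane_bounded C -> (0 < k)%N ->
  turn_invariant C p (2 * pi / k%:R) -> C x ->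
  (forall i, P i = standard_piece C p x i) ->
  2 * (1 - cos (2 * pi / k%:R)) * edist p x ^+ 2 <= max_rel_diameter P ^+ 2.
Proof.
move=> Cb k0 Ct Cx PE; have p0 := @pi_gt0 R.
pose i : 'I_k := Ordinal k0; set t := 2 * pi / k%:R in Ct *.
have t0 : 0 <= t by rewrite divr_ge0// mulr_ge0// ltW.
have -> : 2 * (1 - cos t) * edist p x ^+ 2 =
    edist (polar_point p x 1 0) (polar_point p x 1 t) ^+ 2.
  by rewrite edist_polar_sqr sub0r cosN; ring.
have le_max : edist (polar_point p x 1 0) (polar_point p x 1 t)
    <= max_rel_diameter P.
  apply: le_trans (le_bigmax _ _ i); rewrite PE.
  apply: edist_le_diameter; first exact: standard_piece_bounded.
    split; first by rewrite polar_point1 rotation0.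
    by exists 1, 0; split; rewrite ?mulr0 ?mulr1 ?mul0r.
  split; first by rewrite polar_point1; apply/Ct.
  by exists 1, t; split; rewrite ?mulr0 ?mulr1 ?mul0r.
by rewrite ler_sqr ?nnegrE ?(le_trans _ le_max) ?edist_ge0.
Qed.

(** * Comparison of the two ends of the chain *)

Lemma prime_least_divisor (d n : nat) : (1 < d)%N -> (d %| n)%N ->
  (forall k, (1 < k)%N -> (k %| n)%N -> (d <= k)%N) -> prime d.
Proof.
move=> d1 dn dmin; suff <- : pdiv d = d by exact: pdiv_prime.
apply/eqP; rewrite eqn_leq dvdn_leq ?pdiv_dvd ?(ltnW d1)//=.
by apply: dmin; [exact/prime_gt1/pdiv_prime | exact: dvdn_trans (pdiv_dvd d) dn].
Qed.

(** The bounds are [rho^2 <= (4/3) r^2], as [m >= 6], and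
    [d_M^2 >= 2 (1 - cos (2 pi / k)) r^2 > (4/3) r^2]. *)
Lemma few_pieces_gt_circumradius {R : realType} (C : set (R * R))
  (k m : nat) (P : 'I_k -> set (R * R)) (p x : R * R) :
  compact C -> convex_set C -> interior C p -> closest_boundary_point C p x ->
  (0 < k)%N -> turn_invariant C p (2 * pi / k%:R) ->
  cos (2 * pi / k%:R) < 1 / 3 :> R -> (6 <= m)%N ->
  turn_invariant C p (2 * pi / m%:R) ->
  (forall i, P i = standard_piece C p x i) ->
  circumradius C p < max_rel_diameter P.
Proof.
move=> Ccomp Cconv pint xcl k0 Ck c3 m6 Cm PE.
have Cb := compact_plane_bounded Ccomp.
have Cp : C p by exact: interior_subset pint.
have Cx : C x by rewrite (closure_id C).1; [exact: xcl.1.1 | exact: compact_closed].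
have chord := closest_chord_le Cb k0 Ck Cx PE.
have cos_m := @cos_sqr_half_turn R _ m6.
have m3 : (3 <= m)%N by exact: leq_trans m6.
have rad := circumradius_cos_le Cconv pint xcl m3 Cm.
have px := center_neq_closest pint xcl.
have r0 : 0 < edist p x by exact: edist_gt0.
have rho0 : 0 <= circumradius C p.
  exact: le_trans (edist_ge0 p p) (edist_le_circumradius Cb Cp Cp).
have D0 : 0 <= max_rel_diameter P by exact: bigmax_ge_id.
have c0 : 0 <= cos (pi / m%:R) :> R.
  have p0 := @pi_gt0 R; have m6R : 6 <= m%:R :> R by rewrite ler_nat.
  have h0 : 0 < pi / m%:R :> R by rewrite divr_gt0//; lra.
  have h1 : pi / m%:R <= pi / 2 :> R by rewrite ler_pM2l// lef_pV2 ?posrE; lra.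
  by apply: cos_ge0_pihalf; apply/andP; split; lra.
rewrite -ltr_sqr ?nnegrE//; apply: lt_le_trans chord.
have rad2 : (circumradius C p * cos (pi / m%:R)) ^+ 2 <= edist p x ^+ 2.
  by rewrite ler_sqr ?nnegrE ?mulr_ge0 ?edist_ge0.
rewrite exprMn in rad2.
have r20 : 0 < edist p x ^+ 2 by rewrite exprn_gt0.
have rho20 : 0 <= circumradius C p ^+ 2 by exact: sqr_ge0.
have le34 : circumradius C p ^+ 2 * (3 / 4) <= edist p x ^+ 2.
  by apply: le_trans rad2; rewrite ler_wpM2l.
have lt43 : 4 / 3 * edist p x ^+ 2 <
    2 * (1 - cos (2 * pi / k%:R)) * edist p x ^+ 2 by rewrite ltr_pM2r//; lra.
by apply: le_lt_trans lt43; lra.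
Qed.

Unset Implicit Arguments.

Theorem theorem3p7 (R : realType) (C : set (R * R)) (chi kC : nat)
    (ks : seq nat) (P : forall k : nat, 'I_k -> set (R * R))
    (C_body : convex_body C)
    (C_multi : multi_rot_symmetric C)
    (chi_min : minimal_degree C chi)
    (chi_ge3 : (3 <= chi)%N)
    (kC_max : maximal_degree C kC)
    (ks_sorted : sorted ltn ks)
    (ks_divisors : forall k : nat, (k \in ks) = (1 < k)%N && (k %| kC)%N)
    (P_standard : forall k : nat, k \in ks -> standard_partition C (P k)) :
  (forall i : nat, (i.+1 < size ks)%N ->
     max_rel_diameter (P (nth 0%N ks i)) =
     max_rel_diameter (P (nth 0%N ks i.+1)))
  <-> (7 <= chi)%N.

Proof.
have [Ccomp Cconv Cint] := C_body.
have [[chi2 [p pchi]] chi_least] := chi_min.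
have [[kC2 [q qkC]] kC_greatest] := kC_max.
have Cb := compact_plane_bounded Ccomp.
have sym k : rot_symmetric C k -> turn_invariant C p (2 * pi / k%:R).
  by move=> [k2 [c ck]]; case: (center_turn_invariant Ccomp chi2 k2 pchi ck).
have Cchi := sym _ chi_min.1; have CkC := sym _ kC_max.1.
have Cp : C p by case: pchi.
have chi0 : (0 < chi)%N by exact: ltnW.
have kC0 : (0 < kC)%N by exact: ltnW.
have pint : interior C p := interior_center Cconv Cint chi2 Cchi.
have chi_kC : (chi %| kC)%N.
  have lcm_sym : rot_symmetric C (lcmn chi kC).
    split.
      by apply: leq_trans chi2 _; rewrite dvdn_leq ?dvdn_lcml ?lcmn_gt0 ?chi0.
    exists p; split=> //; apply/rotation_image_invariant.
    exact: turn_invariant_lcm.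
  suff <- : lcmn chi kC = kC by exact: dvdn_lcml.
  apply/eqP; rewrite eqn_leq kC_greatest//=.
  by rewrite dvdn_leq ?dvdn_lcmr ?lcmn_gt0 ?chi0.
have chi_ks : chi \in ks by rewrite ks_divisors chi2.
have kC_ks : kC \in ks by rewrite ks_divisors kC2 dvdnn.
have piece k : k \in ks -> exists x,
    [/\ turn_invariant C p (2 * pi / k%:R), (chi <= k)%N,
     closest_boundary_point C p x & forall i, P k i = standard_piece C p x i].
  move=> kks; have [c [x [ck xcl PE]]] := P_standard k kks.
  have k2 : (2 <= k)%N by move: kks; rewrite ks_divisors => /andP[].
  have [cp Ck] := center_turn_invariant Ccomp chi2 k2 pchi ck; subst c.
  by exists x; split=> //; apply: chi_least; split=> //; exists p.
have diam_narrow k : k \in ks -> (6 <= k)%N ->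
    max_rel_diameter (P k) = circumradius C p.
  move=> kks k6; have [x [Ck _ xcl PE]] := piece k kks.
  exact: max_rel_diameter_narrow Cb Cp (center_neq_closest pint xcl) k6 PE.
split=> [chain|chi7 i ilt]; last first.
  have big k : k \in ks -> (6 <= k)%N.
    move=> /piece[x [_ chik _ _]]; exact: leq_trans (ltnW chi7) chik.
  have [n0 n1] : nth 0%N ks i \in ks /\ nth 0%N ks i.+1 \in ks.
    by split; apply: mem_nth => //; exact: ltnW.
  by rewrite !diam_narrow// big.
have same k : k \in ks -> max_rel_diameter (P k) =
    max_rel_diameter (P (nth 0%N ks 0)).
  move=> kks; rewrite -(nth_index 0%N kks).
  have : (index k ks < size ks)%N by rewrite index_mem.
  by elim: (index k ks) => // n IH nlt; rewrite -chain// IH// ltnW.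
rewrite leqNgt; apply/negP => chi7.
have chi_prime : prime chi.
  apply: prime_least_divisor chi2 chi_kC _ => k k1 kkC.
  by have [|x []] := piece k; first by rewrite ks_divisors k1.
have kC6 : (6 <= kC)%N.
  have chi_neq : chi != kC.
    apply/eqP => chiE; have [k [l [kl sk sl]]] := C_multi; apply: kl.
    have deg m : rot_symmetric C m -> m = chi.
      move=> sm; apply/eqP; rewrite eqn_leq chi_least// andbT chiE.
      exact: kC_greatest.
    by rewrite (deg _ sk) (deg _ sl).
  have [d dE] := dvdnP chi_kC; rewrite dE.
  have d2 : (2 <= d)%N.
    by case: d dE => [|[|d]]// dE; [rewrite dE in kC0 | rewrite dE mul1n eqxx in chi_neq].
  exact: leq_mul d2 chi_ge3.
have cos_chi : cos (2 * pi / chi%:R) < 1 / 3 :> R.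
  move: chi_prime chi_ge3 chi7; clear.
  case: chi => [|[|[|[|[|[|[|c]]]]]]]// _ _ _; last exact: cos_fifth_turn_lt.
  by rewrite cos_third_turn; lra.
have [x [_ _ xcl PE]] := piece chi chi_ks.
have := few_pieces_gt_circumradius Ccomp Cconv pint xcl chi0 Cchi cos_chi
  kC6 CkC PE.
by rewrite (same _ chi_ks) -(same _ kC_ks) diam_narrow// ltxx.
Qed.
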